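(* Let $R$ be a commutative ring and let $S$ be the antipode of the Hopf algebra $\mathtt{NCQSym}$ over $R$. Then for every $n\geq0$ and every composition $\alpha\vDash n$ we have $$S(\mathrm{M}_{\alpha}^{\operatorname{Id}_{n}})=(-1)^{\ell(\alpha)}\mathrm{E}_{\alpha^{r}}^{w^{0}_{n}}.$$
   Context: Compositions. A composition $\alpha\vDash n$ of an integer $n\geq0$ is a finite sequence $(\alpha_{1},\ldots,\alpha_{\ell})$ of positive integers summing to $n$; $\ell(\alpha)=\ell$, and $\emptyset$ is the only composition of $0$. For compositions $\alpha,\beta$ of the same $n$, $\beta\preceq\alpha$ (equivalently $\alpha\succeq\beta$) means that $\beta$ refines $\alpha$, i.e., $\beta$ is the concatenation, in order, of compositions of $\alpha_{1},\ldots,\alpha_{\ell}$. The reversal $\alpha^{r}$ is $\alpha$ written in the opposite order. Put $\mathbb{N}_{n}=\{1,\ldots,n\}$. The Hopf algebra $\mathtt{NCQSym}$ (word quasi-symmetric functions). A set composition $\mathbf{A}=(A_{1},\ldots,A_{\ell})\vDash\mathbb{N}_{n}$ is an ordered collection of non-empty pairwise disjoint sets with union $\mathbb{N}_{n}$. In the ring of power series over $R$ in non-commuting variables $x_{1},x_{2},\ldots$, for $\mathbf{A}\vDash\mathbb{N}_{n}$ of length $\ell$ and $I=\{i_{1}<\cdots<i_{\ell}\}\subseteq\mathbb{N}$, let $x_{I}^{\mathbf{A}}=x_{\eta_{1}}x_{\eta_{2}}\cdots x_{\eta_{n}}$, where $\eta_{k}=i_{j}$ if $k\in A_{j}$, and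 set $\mathrm{M}_{\mathbf{A}}=\sum_{|I|=\ell}x_{I}^{\mathbf{A}}$ (with $\mathrm{M}_{\emptyset}=1$). $\mathtt{NCQSym}$ is the free $R$-module with basis $\{\mathrm{M}_{\mathbf{A}}\}$, $\mathbf{A}$ running over set compositions of $\mathbb{N}_{n}$ for all $n\geq0$, graded by $n$; it is closed under the product of power series. Its co-multiplication is $\Delta(\mathrm{M}_{\mathbf{A}})=\sum_{k=0}^{\ell}\mathrm{M}_{\operatorname{st}(A_{1},\ldots,A_{k})}\otimes\mathrm{M}_{\operatorname{st}(A_{k+1},\ldots,A_{\ell})}$, where $\operatorname{st}$ transports a set composition of a finite $X\subseteq\mathbb{N}$ to one of $\mathbb{N}_{|X|}$ via the order-preserving bijection $X\to\mathbb{N}_{|X|}$; the co-unit is the projection onto degree $0$. This is a connected graded bi-algebra, hence a Hopf algebra, whose antipode is the two-sided convolution inverse of the identity. For $\alpha\vDash n$ and $\rho\in S_{n}$, $\mathbf{A}_{\alpha}^{\rho}\vDash\mathbb{N}_{n}$ is the set composition whose $j$th set is $\{\rho(k)\;|\;\alpha_{1}+\cdots+\alpha_{j-1}<k\leq\alpha_{1}+\cdots+\alpha_{j}\}$. Set $\mathrm{M}_{\alpha}^{\rho}=\mathrm{M}_{\mathbf{A}_{\alpha}^{\rho}}$ and $\mathrm{E}_{\alpha}^{\rho}=\sum_{\beta\succeq\alpha}\mathrm{M}_{\beta}^{\rho}$. $\operatorname{Id}_{n}\in S_{n}$ is the identity and $w^{0}_{n}\in S_{n}$ is the longest element, $w^{0}_{n}(i)=n+1-i$.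 *)

(* Defs.v *)
From HB Require Import structures.
From mathcomp Require Import all_boot all_order all_fingroup all_algebra.
From mathcomp Require Import finmap all_classical monalg.

Set Implicit Arguments.
Unset Strict Implicit.
Unset Printing Implicit Defensive.

Import GRing.Theory.

Local Open Scope fset_scope.
Local Open Scope classical_set_scope.
Local Open Scope ring_scope.

(* The carrier {malg R[K]} of finitely supported functions K -> R is only given
   an R-module structure by the library when R is nontrivial; [freemod R K] is
   the same carrier with the R-module structure for an arbitrary ring R. *)
Definition freemod (R : pzRingType) (K : choiceType) : Type := {malg R[K]}.

HB.instance Definition _ (R : pzRingType) (K : choiceType) :=
  GRing.Zmodule.copy (freemod R K) {malg R[K]}.

Section FreeModule.
Variables (R : pzRingType) (K : choiceType).
Implicit Types (u v : freemod R K) (c : R) (k : K).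

Definition fscale c u : freemod R K := [malg k in msupp u => c * u@_k].

Lemma fscaleE c u k : (fscale c u)@_k = c * u@_k.
Proof.
rewrite mcoeffE; case: (boolP (k \in msupp u)) => // /mcoeff_outdom ->.
by rewrite mulr0.
Qed.

Fact fscaleA c d u : fscale c (fscale d u) = fscale (c * d) u.
Proof. by apply/malgP => k; rewrite !fscaleE mulrA. Qed.
Fact fscale1 : left_id 1 fscale.
Proof. by move=> u; apply/malgP => k; rewrite fscaleE mul1r. Qed.
Fact fscaleDr : right_distributive fscale +%R.
Proof.
move=> c u v; apply/malgP => k.
by rewrite mcoeffD !fscaleE -mulrDr -[in RHS]mcoeffD.
Qed.
Fact fscaleDl u : {morph fscale^~ u : c d / c + d}.
Proof. by move=> c d; apply/malgP => k; rewrite mcoeffD !fscaleE mulrDl. Qed.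

HB.instance Definition _ :=
  GRing.Zmodule_isLmodule.Build R (freemod R K)
    fscaleA fscale1 fscaleDr fscaleDl.

Lemma coeffZ c u k : (c *: u)@_k = c * u@_k.
Proof. exact: fscaleE. Qed.

Lemma coeffD u v k : (u + v)@_k = u@_k + v@_k.
Proof. exact: mcoeffD. Qed.

Lemma coeff0 k : (0 : freemod R K)@_k = 0.
Proof. exact: mcoeff0. Qed.

Lemma coeff_sum (I : Type) (r : seq I) (P : pred I) (F : I -> freemod R K) k :
  (\sum_(i <- r | P i) F i)@_k = \sum_(i <- r | P i) (F i)@_k.
Proof. exact: (raddf_sum (@mcoeff K R k)). Qed.

Definition fbasis k : freemod R K := << 1 *g k >>.

Lemma coeff_fbasis k l : (fbasis k)@_l = (k == l)%:R.
Proof. exact: mcoeffU. Qed.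

Definition linext (V : lmodType R) (h : K -> V) u : V :=
  \sum_(k <- msupp u) u@_k *: h k.

Lemma linextEw (V : lmodType R) (h : K -> V) u (d : {fset K}) :
  (msupp u `<=` d)%fset -> linext h u = \sum_(k <- d) u@_k *: h k.
Proof.
move=> le; rewrite /linext; apply: big_fset_incl => // k _ /mcoeff_outdom ->.
by rewrite scale0r.
Qed.

Fact linext_is_linear (V : lmodType R) (h : K -> V) : linear (linext h).
Proof.
move=> c u v; pose d := (msupp u `|` msupp v `|` msupp (c *: u + v))%fset.
rewrite !(@linextEw _ _ _ d) ?fsubsetUr //.
- rewrite scaler_sumr -big_split; apply: eq_bigr => k _ /=.
  by rewrite coeffD coeffZ scalerDl scalerA.
- by apply: fsubsetU; rewrite fsubsetUr.
- by apply: fsubsetU; rewrite fsubsetUl.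
Qed.

HB.instance Definition _ (V : lmodType R) (h : K -> V) :=
  GRing.isLinear.Build R (freemod R K) V *:%R (linext h) (linext_is_linear h).

Lemma linext_fbasis (V : lmodType R) (h : K -> V) k : linext h (fbasis k) = h k.
Proof.
rewrite (@linextEw _ _ _ [fset k]%fset) ?msuppU_le // big_seq_fset1.
by rewrite coeff_fbasis eqxx scale1r.
Qed.

End FreeModule.

(* Tensor products of free modules: the free module on pairs of basis elements,
   fbasis (k, l) standing for fbasis k (x) fbasis l. *)
Definition tens (R : pzRingType) (K L : choiceType)
    (u : freemod R K) (v : freemod R L) : freemod R (K * L)%type :=
  linext (fun k => linext (fun l => fbasis R (k, l)) v) u.

Definition tensmap (R : pzRingType) (K K' L L' : choiceType)
    (f : {linear freemod R K -> freemod R K'})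
    (g : {linear freemod R L -> freemod R L'}) :
    freemod R (K * L)%type -> freemod R (K' * L')%type :=
  linext (fun p => tens (f (fbasis R p.1)) (g (fbasis R p.2))).

(* N_n = {1, ..., n} is encoded as {0, ..., n - 1}. *)
Definition Nn (n : nat) : {fset nat} := [fset i in iota 0 n]%fset.

Definition is_setcomp (X : {fset nat}) (A : seq {fset nat}) : bool :=
  [&& fset0 \notin A, pairwise (fun B C => [disjoint B & C]%fset) A
    & (\bigcup_(B <- A) B == X)%fset].

Lemma is_setcompP (X : {fset nat}) (A : seq {fset nat}) : reflect
  [/\ (forall B, B \in A -> exists i, i \in B),
      (forall j k i, (j < size A)%N -> (k < size A)%N ->
         i \in nth fset0 A j -> i \in nth fset0 A k -> j = k)
    & forall i, i \in X = has (fun B : {fset nat} => i \in B) A]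
  (is_setcomp X A).
Proof.
have bigE i : (i \in (\bigcup_(B <- A) B)%fset)
            = has (fun B : {fset nat} => i \in B) A.
  by elim: A => [|B A IH] /=; rewrite ?big_nil ?big_cons ?inE // IH.
apply: (iffP and3P) => [[A0 dA /eqP <-]|[A0 dA XE]]; split.
- by move=> B BA; apply/fset0Pn; apply: contraNneq A0 => <-.
- have ltdis j k i : (j < k < size A)%N ->
      i \in nth fset0 A j -> i \in nth fset0 A k -> false.
    move=> /andP[jk kA] ij ik; move/(pairwiseP fset0): dA => dA.
    have := dA j k (ltn_trans jk kA) kA jk.
    by move/fdisjointP/(_ i ij); rewrite ik.
  move=> j k i jA kA ij ik; case: (ltngtP j k) => // [jk|kj].
    by have := ltdis j k i; rewrite jk kA => /(_ isT ij ik).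
  by have := ltdis k j i; rewrite kj jA => /(_ isT ik ij).
- exact: bigE.
- by apply/negP => /A0[i]; rewrite inE.
- apply/(pairwiseP fset0) => j k jA kA jk; apply/fdisjointP => i ij.
  by apply/negP => ik; move: jk; rewrite (dA j k i jA kA ij ik) ltnn.
- by apply/eqP/fsetP => i; rewrite bigE XE.
Qed.

(* Set compositions of N_n for all n >= 0; n is recovered as the number of
   points covered. *)
Definition scdeg (A : seq {fset nat}) : nat := #|` (\bigcup_(B <- A) B)%fset|.

Record setcomp : Type := SetComp {
  scblocks :> seq {fset nat};
  _ : is_setcomp (Nn (scdeg scblocks)) scblocks
}.

HB.instance Definition _ := [isSub for scblocks].
HB.instance Definition _ := [Choice of setcomp by <:].

Lemma mem_Nn n i : (i \in Nn n) = (i < n)%N.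
Proof. by rewrite inE /= mem_iota. Qed.

Lemma card_Nn n : #|` Nn n| = n.
Proof. by rewrite card_fseq undup_id ?iota_uniq ?size_iota. Qed.

Lemma scdegE n A : is_setcomp (Nn n) A -> scdeg A = n.
Proof. by case/and3P=> _ _ /eqP E; rewrite /scdeg E card_Nn. Qed.

Lemma is_setcomp_deg n A : is_setcomp (Nn n) A -> is_setcomp (Nn (scdeg A)) A.
Proof. by move=> AP; rewrite (scdegE AP). Qed.

Definition to_setcomp n A (AP : is_setcomp (Nn n) A) : setcomp :=
  SetComp (is_setcomp_deg AP).

Fact empty_setcomp_proof : is_setcomp (Nn 0) [::].
Proof. by apply/is_setcompP; split=> // i; rewrite mem_Nn. Qed.
Definition setcomp0 : setcomp := to_setcomp empty_setcomp_proof.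

(* The order preserving bijection X -> N_|X|: i is sent to its position in the
   increasing enumeration of X. *)
Definition rank (X : {fset nat}) (i : nat) : nat := index i (sort leq X).

Definition rank_set (X B : {fset nat}) : {fset nat} :=
  [fset rank X i | i in B]%fset.

Definition st (A : seq {fset nat}) : seq {fset nat} :=
  map (rank_set (\bigcup_(B <- A) B)%fset) A.

Lemma rank_inj X : {in X &, injective (rank X)}.
Proof.
move=> i j iX jX; apply: (@index_inj _ 0 (sort leq X)); by rewrite mem_sort.
Qed.

Lemma rank_image X : rank_set X X = Nn #|` X|.
Proof.
apply/fsetP => j; rewrite mem_Nn; apply/imfsetP/idP => [[i iX ->]|jX].
  by rewrite -(size_sort leq) index_mem mem_sort.
exists (nth 0%N (sort leq X) j); last first.
  by rewrite /rank index_uniq ?size_sort // sort_uniq fset_uniq.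
by rewrite /= -(mem_sort leq) mem_nth // size_sort.
Qed.

Lemma st_is_setcomp (X : {fset nat}) (A : seq {fset nat}) :
  is_setcomp X A -> is_setcomp (Nn #|` X|) (st A).
Proof.
move=> AP; have /and3P[_ _ /eqP XE] := AP; rewrite /st XE.
case/is_setcompP: AP => A0 dA AX.
have sub B i : B \in A -> i \in B -> i \in X.
  by move=> BA iB; rewrite AX; apply/hasP; exists B.
apply/is_setcompP; split.
- move=> C /mapP[B /A0[i iB] ->]; exists (rank X i).
  by apply/imfsetP; exists i.
- move=> j k i; rewrite size_map => jA kA; rewrite !(nth_map fset0) //.
  move=> /imfsetP[a /= aj ->] /imfsetP[b /= bk] /rank_inj ab.
  apply: (dA j k a) => //; rewrite ab //.
    exact: sub (mem_nth _ jA) aj.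
  exact: sub (mem_nth _ kA) bk.
- move=> i; rewrite -rank_image has_map; apply/imfsetP/hasP.
    case=> a /=; rewrite AX => /hasP[B BA aB] ->; exists B => //=.
    by apply/imfsetP; exists a.
  by case=> B BA /= /imfsetP[a /= aB ->]; exists a => //; apply: sub aB.
Qed.

Lemma is_setcomp_subseq X A B : subseq B A -> is_setcomp X A ->
  is_setcomp (\bigcup_(C <- B) C)%fset B.
Proof.
move=> BA /and3P[A0 dA _]; apply/and3P; split=> //.
- by apply: contra A0; apply: mem_subseq.
- exact: subseq_pairwise dA.
Qed.

Lemma st_subseq (A : setcomp) B :
  subseq B A -> is_setcomp (Nn #|` (\bigcup_(C <- B) C)%fset|) (st B).
Proof.
by case: A => A AP /= BA; apply/st_is_setcomp/(is_setcomp_subseq BA AP).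
Qed.

(* st(A_1, ..., A_k) and st(A_(k+1), ..., A_l). *)
Definition sttake (k : nat) (A : setcomp) : setcomp :=
  to_setcomp (st_subseq (take_subseq A k)).
Definition stdrop (k : nat) (A : setcomp) : setcomp :=
  to_setcomp (st_subseq (drop_subseq A k)).

(* Power series in the non-commuting variables x_0, x_1, x_2, ...: the
   coefficient of x_(w_1) x_(w_2) ... x_(w_n) is the value at [:: w_1; ...; w_n].
   Shifting the indices of the variables by one does not affect M_A. *)
Definition ncseries (R : pzRingType) : Type := seq nat -> R.

Definition ncseries1 (R : pzRingType) : ncseries R := fun w => (w == [::])%:R.

Definition ncseries_mul (R : pzRingType) (f g : ncseries R) : ncseries R :=
  fun w => \sum_(i < (size w).+1) f (take i w) * g (drop i w).

(* The word of the monomial x_I^A, where A is a set composition of N_n: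
   eta_k = i_j for k in A_j. *)
Definition xmonomial (n : nat) (A : seq {fset nat}) (I : {fset nat}) : seq nat :=
  [seq nth 0%N (sort leq I) (find (fun B : {fset nat} => k \in B) A)
     | k <- iota 0 n].

(* The coefficient at w of the infinite sum over I: at most one I contributes
   to it, see [MseriesE] below. *)
Definition Mseries (R : pzRingType) (A : setcomp) : ncseries R :=
  fun w => \sum_(I \in [set I : {fset nat} | #|` I| = size A])
             ((w == xmonomial (scdeg A) A I)%:R : R).

(* NCQSym as the free R-module on the M_A; it is realized inside the power
   series by the injective, multiplicative map [toseries]. *)
Notation ncqsym R := (freemod R setcomp).

Definition Mb (R : pzRingType) (A : setcomp) : ncqsym R := fbasis R A.

Definition toseries (R : pzRingType) (u : ncqsym R) : ncseries R :=
  fun w => \sum_(A <- msupp u) u@_A * Mseries R A w.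

(* The coefficient of M_C in a word quasi-symmetric series is the coefficient
   of x_I^C with I the first l(C) indices. Hence M_A M_B is the sum below, see
   [toseries_mul] below. *)
Definition Mmul (R : comPzRingType) (A B : setcomp) : ncqsym R :=
  \sum_(C \in [set C : setcomp | scdeg C = (scdeg A + scdeg B)%N])
    ncseries_mul (Mseries R A) (Mseries R B)
      (xmonomial (scdeg C) C (Nn (size C))) *: Mb R C.

Definition ncmul (R : comPzRingType) :
    freemod R (setcomp * setcomp)%type -> ncqsym R :=
  linext (fun p => Mmul R p.1 p.2).

Definition ncunit (R : pzRingType) (c : R) : ncqsym R := c *: Mb R setcomp0.

Definition nccomul (R : pzRingType) :
    ncqsym R -> freemod R (setcomp * setcomp)%type :=
  linext (fun A : setcomp => \sum_(0 <= k < (size A).+1)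
    tens (Mb R (sttake k A)) (Mb R (stdrop k A))).

Definition nccounit (R : pzRingType) (u : ncqsym R) : R := u@_setcomp0.

Definition convolution (R : comPzRingType) (f g : {linear ncqsym R -> ncqsym R})
    (u : ncqsym R) : ncqsym R :=
  ncmul (tensmap f g (nccomul u)).

Definition is_antipode (R : comPzRingType) (S : {linear ncqsym R -> ncqsym R}) :
    Prop :=
  (forall u, convolution S idfun u = ncunit (nccounit u)) /\
  (forall u, convolution idfun S u = ncunit (nccounit u)).

(* The set composition of the positions of a word, ordered by letter. *)
Definition letter_block (w : seq nat) (a : nat) : {fset nat} :=
  [fset i in iota 0 (size w) | nth 0%N w i == a]%fset.

Definition word_blocks (w : seq nat) : seq {fset nat} :=
  map (letter_block w) (sort leq (undup w)).

Lemma letter_blockP w a (i : nat) :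
  (i \in letter_block w a) = (i < size w)%N && (nth 0%N w i == a).
Proof. by rewrite !inE /= mem_iota. Qed.

Fact word_blocks_proof w : is_setcomp (Nn (size w)) (word_blocks w).
Proof.
apply/is_setcompP; split.
- move=> B /mapP[a]; rewrite mem_sort mem_undup => aw ->.
  exists (index a w); rewrite letter_blockP index_mem aw /=.
  by rewrite nth_index.
- move=> j k i; rewrite size_map => jA kA; rewrite !(nth_map 0%N) //.
  rewrite !letter_blockP => /andP[_ /eqP Ej] /andP[_ /eqP Ek].
  apply/eqP; rewrite -(nth_uniq 0%N jA kA) ?sort_uniq ?undup_uniq //.
  by rewrite -Ej -Ek.
- move=> i; rewrite mem_Nn has_map; apply/idP/hasP => [iw|[a _ /=]]; last first.
    by rewrite letter_blockP => /andP[].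
  exists (nth 0%N w i); first by rewrite mem_sort mem_undup mem_nth.
  by rewrite /= letter_blockP iw eqxx.
Qed.

Definition word_setcomp (w : seq nat) : setcomp :=
  to_setcomp (word_blocks_proof w).

Lemma scdeg_word w : scdeg (word_setcomp w) = size w.
Proof. exact: (scdegE (word_blocks_proof w)). Qed.

Lemma size_word w : size (word_setcomp w) = #|` [fset x in w]|.
Proof. by rewrite size_map size_sort card_fseq. Qed.

Lemma sort_fset_seq (w : seq nat) :
  sort leq [fset x in w]%fset = sort leq (undup w).
Proof.
apply/(perm_sortP leq_total leq_trans anti_leq)/uniq_perm; rewrite ?fset_uniq ?undup_uniq //.
by move=> x; rewrite mem_undup inE.
Qed.

Lemma scblocksP (A : setcomp) : is_setcomp (Nn (scdeg A)) A.
Proof. by case: A. Qed.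

Lemma find_block (A : setcomp) (i j : nat) : (j < size A)%N ->
  i \in nth fset0 A j -> find (fun B : {fset nat} => i \in B) A = j.
Proof.
have /is_setcompP[_ dA _] := scblocksP A.
move=> jA ij.
have hA : has (fun B : {fset nat} => i \in B) A.
  by apply/hasP; exists (nth fset0 A j); rewrite ?mem_nth.
apply: (dA _ _ i) => //; first by rewrite -has_find.
exact: (nth_find fset0 hA).
Qed.

Lemma find_blockE (A : setcomp) (i j : nat) :
  (i < scdeg A)%N ->
  (i \in nth fset0 A j) = (find (fun B : {fset nat} => i \in B) A == j).
Proof.
have /is_setcompP[_ _ cA] := scblocksP A.
rewrite -mem_Nn cA => hA; apply/idP/eqP => [ij|<-].
  case: (ltnP j (size A)) => jA; first exact: find_block.
  by rewrite nth_default // in_fset0 in ij.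
exact: (nth_find fset0 hA).
Qed.

Lemma find_lt (A : setcomp) i : (i < scdeg A)%N ->
  (find (fun B : {fset nat} => i \in B) A < size A)%N.
Proof.
have /is_setcompP[_ _ cA] := scblocksP A.
by rewrite -has_find -cA mem_Nn.
Qed.

Lemma block_lt (A : setcomp) i j : i \in nth fset0 A j -> (i < scdeg A)%N.
Proof.
have /is_setcompP[_ _ cA] := scblocksP A.
rewrite -mem_Nn cA => ij; case: (ltnP j (size A)) => jA.
  by apply/hasP; exists (nth fset0 A j); rewrite ?mem_nth.
by rewrite nth_default // in_fset0 in ij.
Qed.

Lemma setcomp_eq (A B : setcomp) : scblocks A = scblocks B -> A = B.
Proof. exact: val_inj. Qed.

Section Monomials.
Variables (A : setcomp) (I : {fset nat}).
Hypothesis cI : #|` I| = size A.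
Let w := xmonomial (scdeg A) A I.

Lemma size_xmonomial : size w = scdeg A.
Proof. by rewrite size_map size_iota. Qed.

Lemma nth_xmonomial i : (i < scdeg A)%N ->
  nth 0%N w i = nth 0%N (sort leq I) (find (fun B : {fset nat} => i \in B) A).
Proof. by move=> iA; rewrite (nth_map 0%N) ?size_iota // nth_iota. Qed.

Lemma mem_xmonomial : w =i I.
Proof.
have /is_setcompP[A0 _ _] := scblocksP A.
move=> x; rewrite -(mem_sort leq I).
apply/(nthP 0%N)/(nthP 0%N) => -[i].
  rewrite size_xmonomial => iA; rewrite nth_xmonomial // => <-.
  exists (find (fun B : {fset nat} => i \in B) A) => //.
  by rewrite size_sort cI find_lt.
rewrite size_sort cI => iA <-.
have [k ki] := A0 _ (mem_nth fset0 iA).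
exists k; first by rewrite size_xmonomial (block_lt ki).
by rewrite nth_xmonomial ?(block_lt ki) // (find_block iA ki).
Qed.

Lemma letters_xmonomial : sort leq (undup w) = sort leq I.
Proof.
apply/(perm_sortP leq_total leq_trans anti_leq)/uniq_perm; rewrite ?fset_uniq ?undup_uniq //.
by move=> x; rewrite mem_undup mem_xmonomial.
Qed.

Lemma fset_xmonomial : [fset x in w]%fset = I.
Proof. by apply/fsetP => x; rewrite inE /= mem_xmonomial. Qed.

Lemma word_xmonomial : word_setcomp w = A.
Proof.
apply: setcomp_eq; rewrite /= /word_blocks letters_xmonomial.
apply: (@eq_from_nth _ fset0); rewrite size_map size_sort cI // => j jA.
rewrite (nth_map 0%N) ?size_sort ?cI //; apply/fsetP => i.
rewrite letter_blockP size_xmonomial.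
case: (ltnP i (scdeg A)) => iA /=; last first.
  by apply/esym/negP => /block_lt; rewrite ltnNge iA.
rewrite nth_xmonomial // nth_uniq ?size_sort ?cI ?find_lt ?sort_uniq ?fset_uniq //.
by rewrite find_blockE.
Qed.
End Monomials.

Lemma xmonomial_word w :
  xmonomial (scdeg (word_setcomp w)) (word_setcomp w) [fset x in w]%fset = w.
Proof.
apply: (@eq_from_nth _ 0%N) => [|i]; first by rewrite size_xmonomial scdeg_word.
rewrite size_xmonomial => iA; have iw := iA; rewrite scdeg_word in iw.
rewrite nth_xmonomial // sort_fset_seq.
have iww : nth 0%N w i \in sort leq (undup w) by rewrite mem_sort mem_undup mem_nth.
rewrite (@find_block _ i (index (nth 0%N w i) (sort leq (undup w)))) ?nth_index //.
  by rewrite size_map index_mem.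
by rewrite (nth_map 0%N) ?index_mem // nth_index // letter_blockP iw eqxx.
Qed.

Lemma MseriesE (R : pzRingType) A w :
  Mseries R A w = (word_setcomp w == A)%:R.
Proof.
rewrite /Mseries; case: eqP => [<-|wA]; last first.
  by apply: fsbig1 => I /= cI; case: eqP => // wE; case: wA; rewrite wE word_xmonomial.
rewrite -(@fsbig_widen _ _ _ _ [set [fset x in w]%fset]) => [|I ->|I [/= cI nI]].
- by rewrite fsbig_set1 xmonomial_word eqxx.
- by rewrite /= size_word.
- by case: eqP => // wE; case: nI; rewrite /= -(@fset_xmonomial (word_setcomp w) I cI) -wE.
Qed.

Lemma toseriesE (R : pzRingType) (u : ncqsym R) w :
  toseries u w = u@_(word_setcomp w).
Proof.
rewrite /toseries; case: (boolP (word_setcomp w \in msupp u)) => [wu|wu].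
  rewrite (big_fsetD1 _ wu) /= MseriesE eqxx mulr1 big_seq big1 ?addr0 // => A.
  by rewrite !inE MseriesE eq_sym => /andP[/negPf -> _]; rewrite mulr0.
rewrite big_seq big1 ?(mcoeff_outdom wu) // => A Au.
rewrite MseriesE; case: eqP => [wA|]; last by rewrite mulr0.
by rewrite wA Au in wu.
Qed.

Lemma toseries_inj (R : pzRingType) : injective (@toseries R).
Proof.
move=> u v uv; apply/malgP => A.
have sA : #|` Nn (size A)| = size A by rewrite card_Nn.
by rewrite -(word_xmonomial sA) -!toseriesE uv.
Qed.

Lemma toseries_basis (R : pzRingType) A : toseries (Mb R A) = Mseries R A.
Proof.
by apply: funext => w; rewrite toseriesE MseriesE coeff_fbasis eq_sym.
Qed.

Lemma word_map (f : nat -> nat) w :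
  {in w &, {mono f : i j / (i <= j)%N}} ->
  word_setcomp (map f w) = word_setcomp w.
Proof.
move=> fm.
have fi : {in w &, injective f}.
  by move=> i j iw jw E; apply/eqP; rewrite eqn_leq -(fm i j) // -(fm j i) // E leqnn.
have E : sort leq (undup (map f w)) = map f (sort leq (undup w)).
  apply: (@sorted_eq _ leq) => //; first exact: leq_trans.
  - exact: anti_leq.
  - exact/sort_sorted/leq_total.
  - apply: (@homo_sorted_in _ _ (mem w) f leq leq) => [i j iw jw||].
    + by rewrite fm.
    + by apply/allP => i; rewrite mem_sort mem_undup.
    + exact/sort_sorted/leq_total.
  - apply: uniq_perm; rewrite ?sort_uniq ?undup_uniq //.
      rewrite map_inj_in_uniq ?sort_uniq ?undup_uniq // => i j.
      by rewrite !mem_sort !mem_undup; apply: fi.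
    move=> x; rewrite mem_sort mem_undup.
    apply/mapP/mapP => -[i iw ->]; exists i => //; move: iw;
      by rewrite mem_sort mem_undup.
apply: setcomp_eq; rewrite /= /word_blocks E -map_comp; apply/eq_in_map => a.
rewrite mem_sort mem_undup => aw /=; apply/fsetP => i.
rewrite !letter_blockP size_map; case: ltnP => //= iw.
rewrite (nth_map 0%N) //; apply/eqP/eqP => [/fi|-> //]; apply=> //.
exact: mem_nth.
Qed.

Lemma word_map_nth s p : sorted ltn s -> all (fun i => i < size s)%N p ->
  word_setcomp (map (nth 0%N s) p) = word_setcomp p.
Proof.
move=> ss /allP ps; apply: word_map => i j /ps ip /ps jp.
exact: (leq_mono_in (sorted_ltn_nth ltn_trans 0%N ss)) ip jp.
Qed.

Lemma sort_fset_ltn (I : {fset nat}) : sorted ltn (sort leq I).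
Proof.
by rewrite ltn_sorted_uniq_leq sort_uniq fset_uniq sort_sorted //; apply: leq_total.
Qed.

(* A quasi-symmetric product: its coefficients depend on a word only through
   its set composition. *)
Lemma ncseries_mul_word (R : pzRingType) A B w (C := word_setcomp w) :
  ncseries_mul (Mseries R A) (Mseries R B) (xmonomial (scdeg C) C (Nn (size C)))
  = ncseries_mul (Mseries R A) (Mseries R B) w.
Proof.
pose p := [seq find (fun B : {fset nat} => k \in B) C | k <- iota 0 (scdeg C)].
have cI : #|` Nn (size C)| = size C by rewrite card_Nn.
have xE I : xmonomial (scdeg C) C I = map (nth 0%N (sort leq I)) p.
  by rewrite -map_comp.
have pC : all (fun i => i < size C)%N p.
  by apply/allP => _ /mapP[k + ->]; rewrite mem_iota => /find_lt.
pose w0 := [fset x in w]%fset.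
have wE : w = map (nth 0%N (sort leq w0)) p by rewrite -xE xmonomial_word.
have sE q : subseq q p -> word_setcomp (map (nth 0%N (sort leq (Nn (size C)))) q)
          = word_setcomp (map (nth 0%N (sort leq w0)) q).
  move=> /mem_subseq qp.
  have qC : all (fun i => i < size C)%N q.
    by apply/allP => x /qp; exact: (allP pC).
  rewrite !word_map_nth ?sort_fset_ltn ?size_sort ?cI //.
  by rewrite -size_word.
clearbody p C; rewrite [in RHS]wE xE /ncseries_mul !size_map; apply: eq_bigr => i _.
by rewrite -!map_take -!map_drop !MseriesE !sE ?take_subseq ?drop_subseq.
Qed.

Lemma size_setcomp (A : setcomp) : (size A <= scdeg A)%N.
Proof.
have cI : #|` Nn (size A)| = size A by rewrite card_Nn.
rewrite -{1}cI -(fset_xmonomial cI) card_fseq.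
by apply: (leq_trans (size_undup _)); rewrite size_xmonomial.
Qed.

Lemma finite_setcomp n : finite_set [set C : setcomp | scdeg C = n].
Proof.
pose f (t : n.-tuple 'I_n) := word_setcomp (map val t).
apply: (@sub_finite_set _ _ (f @` setT)); last exact/finite_image/finite_finset.
move=> C /= CE; have cI : #|` Nn (size C)| = size C by rewrite card_Nn.
pose w := xmonomial (scdeg C) C (Nn (size C)).
have wn : all (fun i => i < n)%N w.
  apply/allP => i; rewrite (mem_xmonomial cI) mem_Nn => iC.
  by apply: (leq_trans iC); rewrite -CE size_setcomp.
have sw : size (pmap insub w : seq 'I_n) == n.
  by rewrite size_pmap_sub (eqP (etrans (esym (all_count _ _)) wn)) size_xmonomial CE.
exists (Tuple sw) => //; rewrite /f /= -[RHS](word_xmonomial cI); congr word_setcomp.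
by rewrite pmap_filter; [apply/all_filterP; apply/allP => i iw; rewrite /= insubT // (allP wn)|exact: insubK].
Qed.

Lemma coeff_Mmul (R : comPzRingType) A B C :
  (Mmul R A B)@_C = if scdeg C == (scdeg A + scdeg B)%N
    then ncseries_mul (Mseries R A) (Mseries R B)
           (xmonomial (scdeg C) C (Nn (size C))) else 0.
Proof.
rewrite /Mmul fsbig_finite /=; last exact: finite_setcomp.
rewrite coeff_sum.
set D := fset_set _.
have DE X : (X \in D) = (scdeg X == scdeg A + scdeg B)%N.
  rewrite in_fset_set; last exact: finite_setcomp.
  by apply/idP/eqP; rewrite inE.
rewrite -DE; case: ifP => CD.
  rewrite (big_fsetD1 _ CD) /= coeffZ coeff_fbasis eqxx mulr1 big_seq big1 ?addr0 //.
  by move=> X; rewrite !inE coeffZ coeff_fbasis => /andP[/negPf -> _]; rewrite mulr0.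
rewrite big_seq big1 // => X XD; rewrite coeffZ coeff_fbasis.
case: eqP => [E|_]; last by rewrite mulr0.
by rewrite -E XD in CD.
Qed.

Lemma toseries_Mmul (R : comPzRingType) A B :
  toseries (Mmul R A B) = ncseries_mul (Mseries R A) (Mseries R B).
Proof.
apply: funext => w; rewrite toseriesE coeff_Mmul ncseries_mul_word scdeg_word.
case: eqP => // wAB; rewrite /ncseries_mul big1 // => i _.
rewrite !MseriesE; case: eqP => [EA|]; rewrite ?mul0r //.
case: eqP => [EB|]; rewrite ?mulr0 //; case: wAB.
by rewrite -EA -EB !scdeg_word -size_cat cat_take_drop.
Qed.

Lemma toseries_mul (R : comPzRingType) (u v : ncqsym R) :
  toseries (ncmul (tens u v)) = ncseries_mul (toseries u) (toseries v).
Proof.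
apply: funext => w.
rewrite toseriesE /ncmul /tens [linext _ u]/linext linear_sum coeff_sum.
rewrite /ncseries_mul; under [RHS]eq_bigr => i _ do rewrite mulr_suml.
rewrite exchange_big; apply: eq_bigr => A _ /=.
rewrite linearZ coeffZ /= [linext _ v]/linext linear_sum coeff_sum mulr_sumr.
under [RHS]eq_bigr => i _ do rewrite mulr_sumr.
rewrite exchange_big; apply: eq_bigr => B _ /=.
rewrite linearZ coeffZ /= linext_fbasis /= -toseriesE toseries_Mmul.
rewrite /ncseries_mul !mulr_sumr; apply: eq_bigr => i _.
by rewrite mulrACA mulrA.
Qed.

Lemma toseries_unit (R : pzRingType) : toseries (Mb R setcomp0) = ncseries1 R.
Proof.
apply: funext => w; rewrite toseries_basis MseriesE /ncseries1.
congr (_%:R); congr nat_of_bool; apply/eqP/eqP => [E|->].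
  by apply: size0nil; rewrite -scdeg_word E (scdegE empty_setcomp_proof).
exact: setcomp_eq.
Qed.

Definition is_composition (n : nat) (a : seq nat) : bool :=
  (0%N \notin a) && (sumn a == n).

Record composition (n : nat) : Type := Composition {
  parts :> seq nat;
  _ : is_composition n parts
}.

HB.instance Definition _ n := [isSub for @parts n].
HB.instance Definition _ n := [Choice of composition n by <:].

Fact rev_composition_proof n (a : composition n) : is_composition n (rev a).
Proof.
by case: a => a /= /andP[a0 an]; rewrite /is_composition mem_rev a0 sumn_rev.
Qed.
Definition rev_composition n (a : composition n) : composition n :=
  Composition (rev_composition_proof a).

Definition refines (b a : seq nat) : Prop :=
  exists2 bs : seq (seq nat),
    all2 (fun c ai => is_composition ai c) bs a & b = flatten bs.

(* The set { rho(k) | a_1 + ... + a_j < k <= a_1 + ... + a_(j+1) } with both k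
   and rho(k) shifted down by one. *)
Definition perm_block n (a : seq nat) (rho : 'S_n) (j : nat) : {fset nat} :=
  [fset val (rho k) | k in 'I_n &
     (sumn (take j a) <= k < sumn (take j.+1 a))%N]%fset.

Definition perm_blocks n (a : seq nat) (rho : 'S_n) : seq {fset nat} :=
  map (perm_block a rho) (iota 0 (size a)).

Lemma sumn_take_le (a : seq nat) j k :
  (j <= k)%N -> (sumn (take j a) <= sumn (take k a))%N.
Proof.
move=> jk; rewrite -(subnKC jk) takeD sumn_cat; exact: leq_addr.
Qed.

Lemma perm_blockP n (a : seq nat) (rho : 'S_n) j (i : nat) : reflect
  (exists2 k : 'I_n, (sumn (take j a) <= k < sumn (take j.+1 a))%N & i = val (rho k))
  (i \in perm_block a rho j).
Proof.
apply: (iffP (imfsetP _ _ _ _)) => [[k /= kP ->]|[k kP ->]].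
  by exists k.
by exists k.
Qed.

Fact perm_blocks_proof n (a : composition n) (rho : 'S_n) :
  is_setcomp (Nn n) (perm_blocks a rho).
Proof.
case: a => a /= /andP[a0 /eqP an].
apply/is_setcompP; split.
- move=> C /mapP[j]; rewrite mem_iota /= add0n => ja ->.
  have kP : (sumn (take j a) < sumn (take j.+1 a))%N.
    rewrite (take_nth 0%N ja) sumn_rcons -addn1 leq_add2l lt0n.
    by apply: contraNneq a0 => <-; apply: mem_nth.
  have kn : (sumn (take j a) < n)%N.
    by apply: (leq_trans kP); rewrite -an -{2}(take_size a) sumn_take_le.
  exists (val (rho (Ordinal kn))); apply/perm_blockP; exists (Ordinal kn) => //=.
  by rewrite leqnn.
- move=> j k i; rewrite size_map size_iota => ja ka.
  rewrite !(nth_map 0%N) ?size_iota // !nth_iota // !add0n.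
  move=> /perm_blockP[x /andP[x1 x2] ->] /perm_blockP[y /andP[y1 y2]].
  move=> /val_inj /perm_inj xy.
  rewrite -{}xy in y1 y2; case: (ltngtP j k) => // [jk|kj].
    by have := leq_trans x2 (leq_trans (sumn_take_le a jk) y1); rewrite ltnn.
  by have := leq_trans y2 (leq_trans (sumn_take_le a kj) x1); rewrite ltnn.
- move=> i; rewrite mem_Nn has_map; apply/idP/hasP => [iln|]; last first.
    by case=> j _ /perm_blockP[k _ ->]; apply: ltn_ord.
  pose x := (rho^-1)%g (Ordinal iln).
  have xa : (x < sumn (take (size a) a))%N by rewrite take_size an.
  have ex : exists m, (x < sumn (take m a))%N by exists (size a).
  case: (ex_minnP ex) => -[|m]; first by rewrite take0.
  move=> xm mmin; exists m.
    by rewrite mem_iota /= add0n; apply: mmin.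
  apply/perm_blockP; exists x; last by rewrite permKV.
  rewrite xm andbT leqNgt; apply/negP => /mmin; by rewrite ltnn.
Qed.

Definition perm_setcomp n (a : composition n) (rho : 'S_n) : setcomp :=
  to_setcomp (perm_blocks_proof a rho).

Definition Mperm (R : pzRingType) n (a : composition n) (rho : 'S_n) : ncqsym R :=
  Mb R (perm_setcomp a rho).

Definition Eperm (R : pzRingType) n (a : composition n) (rho : 'S_n) : ncqsym R :=
  \sum_(b \in [set b : composition n | refines a b]) Mperm R b rho.

Definition longest_perm (n : nat) : 'S_n := perm (@rev_ord_inj n).

(* Main.v *)
(* As power series, the coefficient of M_a^Id at a word w is 1 exactly when w is
   constant on consecutive blocks of lengths a_1, ..., a_l with strictly
   increasing letters.  Similarly M_b^(w0) is the sum of the weakly decreasing words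
   whose maximal runs have lengths b^r; grouping by run lengths, E_(a^r)^(w0) is the
   sum of the words constant on the blocks of a with weakly decreasing letters.
   The coproduct of M_a^Id is
   deconcatenation of a, so by induction on l the claim follows from S * id = eps
   and, for v_1, ..., v_l with l > 0,
     sum_k (-1)^k [v_1 >= ... >= v_k] [v_(k+1) < ... < v_l] = 0,
   where consecutive terms cancel according to the comparison at the cut. *)
Require Import Defs.
From mathcomp Require Import all_boot all_fingroup all_algebra.
From mathcomp Require Import finmap all_classical zify.

Set Implicit Arguments.
Unset Strict Implicit.
Unset Printing Implicit Defensive.
Import GRing.Theory.
Local Open Scope ring_scope.

(** * Words that are constant on consecutive blocks of given lengths *)

Definition expand (a v : seq nat) : seq nat :=
  flatten [seq nseq p.1 p.2 | p <- zip a v].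

Lemma expand_cons c a x v : expand (c :: a) (x :: v) = nseq c x ++ expand a v.
Proof. by []. Qed.

Lemma expand_cat a1 a2 v1 v2 : size a1 = size v1 ->
  expand (a1 ++ a2) (v1 ++ v2) = expand a1 v1 ++ expand a2 v2.
Proof. by move=> sz; rewrite /expand zip_cat // map_cat flatten_cat. Qed.

Lemma size_expand a v : size v = size a -> size (expand a v) = sumn a.
Proof.
elim: a v => [|c a IH] [|x v] //= [sz].
by rewrite expand_cons size_cat size_nseq IH.
Qed.

Lemma rev_expand a v : size v = size a ->
  rev (expand a v) = expand (rev a) (rev v).
Proof.
elim: a v => [|c a IH] [|x v] //= [sz].
rewrite expand_cons rev_cat IH // !rev_cons -!cats1 expand_cat ?size_rev //.
by rewrite expand_cons cats0 rev_nseq.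
Qed.

Lemma nth_expand a v j k : size v = size a ->
  (sumn (take j a) <= k < sumn (take j.+1 a))%N ->
  nth 0%N (expand a v) k = nth 0%N v j.
Proof.
elim: a v j k => [|c a IH] [|x v] // [|j] k /=; rewrite ?take0 ?expand_cons ?nth_cat ?size_nseq.
- by rewrite addn0 => _ kc; rewrite nth_nseq kc.
- move=> [sz] /andP[k1 k2]; rewrite ltnNge (leq_trans (leq_addr _ _) k1) /=.
  by apply: IH => //; lia.
Qed.

Lemma expand_nseq c x : expand c (nseq (size c) x) = nseq (sumn c) x.
Proof. by elim: c => //= c s IH; rewrite expand_cons IH -nseqD. Qed.

(** Adjacent blocks carrying the same letter merge into one block; this is how coarsenings of a
    composition enter. *)
Lemma expand_flatten (bs : seq (seq nat)) v : size v = size bs ->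
  expand (flatten bs) (expand (map size bs) v) = expand (map sumn bs) v.
Proof.
elim: bs v => [|b bs IH] [|x v] //= [sz].
rewrite !expand_cons expand_cat ?size_nseq //.
by rewrite expand_nseq IH.
Qed.

Lemma mem_expand a v : {subset expand a v <= v}.
Proof.
elim: a v => [|c a IH] [|x v] //= y.
rewrite expand_cons mem_cat mem_nseq inE => /orP[/andP[_ ->] //|/IH ->].
by rewrite orbT.
Qed.

Lemma sorted_expand (r r' : rel nat) a v : (forall x, r' x x) ->
  (forall x y, r x y -> r' x y) -> transitive r -> transitive r' ->
  sorted r v -> sorted r' (expand a v).
Proof.
move=> refl rr' tr tr'; rewrite !sorted_pairwise //.
elim: a v => [|c a IH] [|x v] //= /andP[xv sv].
rewrite expand_cons pairwise_cat IH // andbT; apply/andP; split.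
  apply/allrelP => y z; rewrite mem_nseq => /andP[_ /eqP ->] /mem_expand zv.
  exact/rr'/(allP xv).
apply/(pairwiseP 0%N) => i j; rewrite !inE size_nseq => ic jc _.
by rewrite !nth_nseq ic jc.
Qed.

(* A left inverse of [expand a] when no part of [a] is zero. *)
Fixpoint letters (a w : seq nat) : seq nat :=
  if a is c :: a' then head 0%N w :: letters a' (drop c w) else [::].

Lemma size_letters a w : size (letters a w) = size a.
Proof. by elim: a w => //= c a IH w; rewrite IH. Qed.

Lemma letters_expand a v : 0%N \notin a -> size v = size a ->
  letters a (expand a v) = v.
Proof.
elim: a v => [|c a IH] [|x v] //=; rewrite inE negb_or => /andP[c0 a0] [sz].
rewrite expand_cons drop_size_cat ?size_nseq // IH //.
by case: c c0.
Qed.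

(* [w] is constant on consecutive blocks of lengths a_1, a_2, ..., and the
   resulting sequence of letters is [r]-sorted. *)
Definition expandable (r : rel nat) (a w : seq nat) : bool :=
  (w == expand a (letters a w)) && sorted r (letters a w).

Lemma expandable_expand r a v : 0%N \notin a -> size v = size a ->
  expandable r a (expand a v) = sorted r v.
Proof. by move=> a0 sz; rewrite /expandable letters_expand // eqxx. Qed.

Lemma expandableP r a w : 0%N \notin a -> reflect
  (exists2 v, size v = size a /\ w = expand a v & sorted r v) (expandable r a w).
Proof.
move=> a0; apply: (iffP andP) => [[/eqP wE sv]|[v [sv ->] rv]].
  by exists (letters a w); rewrite ?size_letters.
by apply/andP; rewrite [_ && _]expandable_expand.
Qed.

(** * Alternating sums over the cut position, and products of block series *)

Lemma sum_path_sorted (R : comPzRingType) (x : nat) (v : seq nat) :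
  \sum_(k < (size v).+1)
     (-1) ^+ k * (path geq x (take k v) && sorted ltn (drop k v))%:R
  = (path ltn x v)%:R :> R.
Proof.
elim: v x => [|y v IH] x; first by rewrite big_ord1 /= mulr1.
rewrite big_ord_recl /= mul1r.
under eq_bigr => k _ do
  rewrite exprS mulN1r mulNr /= -andbA -mulnb natrM mulrCA.
(* The terms with k > 0 share the factor [y <= x] and sum by induction to -[y <= x]
   [y :: v increasing]. The term k = 0 is [y :: v increasing], so [x < y] remains as factor. *)
rewrite sumrN -mulr_sumr IH.
by rewrite ltnNge; case: (y <= x)%N; rewrite ?mul1r ?subrr // mul0r subr0.
Qed.

(** For a nonempty word the terms with k > 0 form the sum of [sum_path_sorted] with opposite sign,
    and the term k = 0 cancels its value. *)
Lemma sum_sorted_nil (R : comPzRingType) (v : seq nat) :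
  \sum_(k < (size v).+1)
     (-1) ^+ k * (sorted geq (take k v) && sorted ltn (drop k v))%:R
  = (v == [::])%:R :> R.
Proof.
case: v => [|x v]; first by rewrite big_ord1 /= mulr1.
rewrite big_ord_recl /= mul1r.
under eq_bigr => k _ do rewrite exprS mulN1r mulNr.
by rewrite sumrN sum_path_sorted subrr.
Qed.

(** The first factor is supported on words of length [sumn (take k a)], so at most one cut of [w]
    contributes. *)
Lemma ncseries_mul_expandable (R : pzRingType) (r r' : rel nat) a k w :
  0%N \notin a ->
  ncseries_mul (fun u => (expandable r (take k a) u)%:R)
    (fun u => (expandable r' (drop k a) u)%:R) w
  = ((w == expand a (letters a w)) && (sorted r (take k (letters a w))
      && sorted r' (drop k (letters a w))))%:R :> R.
Proof.
move=> a0.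
have t0 : 0%N \notin take k a by apply: contra a0; apply: mem_take.
have d0 : 0%N \notin drop k a by apply: contra a0; apply: mem_drop.
rewrite /ncseries_mul; case: eqP => [|wN] /=; last first.
  apply: big1 => i _.
  case: (expandableP r _ t0) => [[v1 [s1 E1] _]|]; rewrite ?mul0r //.
  case: (expandableP r' _ d0) => [[v2 [s2 E2] _]|]; rewrite ?mulr0 //.
  have wE : w = expand a (v1 ++ v2).
    by rewrite -[LHS](cat_take_drop i) E1 E2 -expand_cat // cat_take_drop.
  case: wN; rewrite {2}wE letters_expand // size_cat s1 s2 -size_cat.
  by rewrite cat_take_drop.
have := size_letters a w; move: (letters a w) => v sv ->.
set w1 := expand (take k a) (take k v); set w2 := expand (drop k a) (drop k v).
have st : size (take k v) = size (take k a) by rewrite !size_take sv.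
have sd : size (drop k v) = size (drop k a) by rewrite !size_drop sv.
have -> : expand a v = w1 ++ w2 by rewrite -expand_cat // !cat_take_drop.
have iP : (size w1 < (size (w1 ++ w2)).+1)%N by rewrite ltnS size_cat leq_addr.
rewrite (bigD1 (Ordinal iP)) //= take_size_cat // drop_size_cat //.
rewrite !expandable_expand // -natrM mulnb big1 ?addr0 // => i iN.
case: (expandableP r _ t0) => [[u [su Eu] _]|]; rewrite ?mul0r //.
case/eqP: iN; apply: val_inj => /=.
rewrite /w1 size_expand // -(size_expand su) -Eu size_takel //.
exact: leq_ord.
Qed.

Lemma ncseries_mul1 (R : pzRingType) (f : ncseries R) :
  ncseries_mul f (ncseries1 R) = f.
Proof.
apply: funext => w; rewrite /ncseries_mul big_ord_recr /= big1 => [|i _].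
  by rewrite take_size drop_size /ncseries1 eqxx mulr1 add0r.
rewrite /ncseries1 -size_eq0 size_drop subn_eq0 leqNgt ltn_ord /=.
by rewrite mulr0.
Qed.

(** * Set compositions into consecutive intervals, and their standardization *)

Fixpoint intervals (s : nat) (a : seq nat) : seq {fset nat} :=
  if a is c :: a' then [fset i in iota s c]%fset :: intervals (s + c) a'
  else [::].

Lemma size_intervals s a : size (intervals s a) = size a.
Proof. by elim: a s => //= c a IH s; rewrite IH. Qed.

Lemma nth_intervals s a j : (j < size a)%N ->
  nth fset0 (intervals s a) j =
  [fset i in iota (s + sumn (take j a)) (nth 0%N a j)]%fset.
Proof.
elim: a s j => [|c a IH] s [|j] //=; first by rewrite addn0.
by rewrite ltnS => ja; rewrite IH // addnA.
Qed.

Lemma take_intervals k s a : take k (intervals s a) = intervals s (take k a).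
Proof. by elim: a k s => [|c a IH] [|k] s //=; rewrite IH. Qed.

Lemma drop_intervals k s a :
  drop k (intervals s a) = intervals (s + sumn (take k a)) (drop k a).
Proof.
elim: a k s => [|c a IH] [|k] s //=; first by rewrite addn0.
by rewrite IH addnA.
Qed.

Lemma bigcup_intervals s a :
  (\bigcup_(B <- intervals s a) B)%fset = [fset i in iota s (sumn a)]%fset.
Proof.
elim: a s => [|c a IH] s /=; first by rewrite big_nil; apply/fsetP => i; rewrite !inE.
rewrite big_cons IH; apply/fsetP => i; rewrite !inE /= !mem_iota; lia.
Qed.

Lemma rank_iota s m i : (s <= i < s + m)%N ->
  rank [fset i in iota s m]%fset i = (i - s)%N.
Proof.
move=> im; rewrite /rank sort_fset_seq undup_id ?iota_uniq //.
rewrite sorted_sort ?iota_sorted //; last exact: leq_trans.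
have {1}-> : i = nth 0%N (iota s m) (i - s) by rewrite nth_iota; lia.
by rewrite index_uniq ?iota_uniq // size_iota; lia.
Qed.

(** The ambient interval stays fixed while the start [t] advances along [a], as the induction
    requires. *)
Lemma rank_intervals s m t a : (s <= t)%N -> (t + sumn a <= s + m)%N ->
  map (rank_set [fset i in iota s m]%fset) (intervals t a)
  = intervals (t - s) a.
Proof.
elim: a t => //= c a IH t st tm; rewrite IH; [|lia..]; congr (_ :: _); last first.
  by congr intervals; lia.
apply/fsetP => i; rewrite inE /= mem_iota; apply/imfsetP/idP => [[j]|im].
  by rewrite inE /= mem_iota => jt ->; rewrite rank_iota; lia.
exists (i + s)%N; first by rewrite inE /= mem_iota; lia.
by rewrite rank_iota; lia.
Qed.

(** The offset disappears, so both halves of a cut of [intervals 0 a] standardize to the same form;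
    the induction on the antipode stays within this family. *)
Lemma st_intervals s a : st (intervals s a) = intervals 0 a.
Proof. by rewrite /st bigcup_intervals rank_intervals // subnn. Qed.

Lemma perm_blocks1 n (a : composition n) : perm_blocks a (1%g : 'S_n) = intervals 0 a.
Proof.
case: a => a /= /andP[_ /eqP an].
apply: (@eq_from_nth _ fset0); rewrite size_map size_iota ?size_intervals // => j ja.
rewrite (nth_map 0%N) ?size_iota // nth_iota // nth_intervals // !add0n.
apply/fsetP => i; rewrite inE /= mem_iota.
have sE : sumn (take j.+1 a) = (sumn (take j a) + nth 0 a j)%N.
  by rewrite (take_nth 0%N) // sumn_rcons.
have sn : (sumn (take j.+1 a) <= n)%N by rewrite -an -{2}(take_size a) sumn_take_le.
apply/perm_blockP/idP => [[k kj ->]|ij]; first by rewrite perm1 -sE.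
have i_n : (i < n)%N by lia.
by exists (Ordinal i_n); rewrite ?perm1 // sE.
Qed.

(** * Words occurring in the basis series of the identity and of the longest element *)

Lemma word_setcompP (A : setcomp) w :
  word_setcomp w = A <->
  exists2 v, sorted ltn v /\ size v = size A &
    w = [seq nth 0%N v (find (fun B : {fset nat} => k \in B) A)
          | k <- iota 0 (scdeg A)].
Proof.
split=> [<-|[v [lt_v sz] ->]].
  exists (sort leq [fset x in w]%fset); last exact/esym/xmonomial_word.
  by rewrite sort_fset_ltn size_sort size_word.
have [uv le_v] : uniq v /\ sorted leq v by apply/andP; rewrite -ltn_sorted_uniq_leq.
have vE : v = sort leq [fset x in v]%fset.
  by rewrite sort_fset_seq undup_id // sorted_sort //; apply: leq_trans.
rewrite {1}vE; apply: word_xmonomial.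
by rewrite card_fseq undup_id.
Qed.

(** The block containing rho(k) is the one whose index range contains k, so reading the word along
    [rho] gives an expanded word. *)
Lemma letter_perm n (b : composition n) (rho : 'S_n) v (k : 'I_n) :
  size v = size b ->
  nth 0%N v (find (fun B : {fset nat} => val (rho k) \in B) (perm_setcomp b rho))
  = nth 0%N (expand b v) k.
Proof.
move=> sz; have /is_setcompP[_ _ cover] := perm_blocks_proof b rho.
have := cover (val (rho k)); rewrite mem_Nn ltn_ord => /esym /hasP[B].
move=> /mapP[j]; rewrite mem_iota /= add0n => jb -> kj; have /perm_blockP[l lj] := kj.
move=> /val_inj /perm_inj kl; rewrite -{}kl in lj.
rewrite (@find_block (perm_setcomp b rho) _ j) /=; first by rewrite (nth_expand _ lj).
  by rewrite size_map size_iota.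
by rewrite (nth_map 0%N) ?size_iota // nth_iota.
Qed.

Lemma composition_pos n (b : composition n) : 0%N \notin parts b.
Proof. by case: b => b /= /andP[]. Qed.

Lemma sumn_composition n (b : composition n) : sumn (parts b) = n.
Proof. by case: b => b /= /andP[_ /eqP]. Qed.

Lemma word_perm1 n (b : composition n) w :
  (word_setcomp w == perm_setcomp b 1%g) = expandable ltn b w.
Proof.
have E v : size v = size b ->
    [seq nth 0%N v (find (fun B : {fset nat} => k \in B) (perm_setcomp b 1%g))
      | k <- iota 0 n] = expand b v.
  move=> sz; have sE : size (expand b v) = n by rewrite size_expand // sumn_composition.
  apply: (@eq_from_nth _ 0%N) => [|k]; first by rewrite size_map size_iota.
  rewrite size_map size_iota => kn; rewrite (nth_map 0%N) ?size_iota //.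
  by rewrite nth_iota // -(letter_perm 1%g (Ordinal kn) sz) perm1.
have sB : size (perm_setcomp b 1%g) = size b by rewrite size_map size_iota.
have dB : scdeg (perm_setcomp b 1%g) = n := scdegE (perm_blocks_proof b (1%g : 'S_n)).
apply/eqP/(expandableP _ _ (composition_pos b)) => [/word_setcompP[v [lt_v]]|].
  by rewrite sB dB => sz; rewrite E // => ->; exists v.
move=> [v [sz ->] lt_v]; apply/word_setcompP; exists v; first by rewrite sB.
by rewrite dB E.
Qed.

(** Reading along the longest element reverses the word: increasing letters on the blocks of [b]
    become decreasing letters on the reversed blocks. *)
Lemma word_perm_longest n (b : composition n) w :
  (word_setcomp w == perm_setcomp b (longest_perm n)) = expandable gtn (rev b) w.
Proof.
set rho := longest_perm n.
have E v : size v = size b ->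
    [seq nth 0%N v (find (fun B : {fset nat} => k \in B) (perm_setcomp b rho))
      | k <- iota 0 n] = expand (rev b) (rev v).
  move=> sz; have sE : size (expand b v) = n by rewrite size_expand // sumn_composition.
  rewrite -rev_expand //.
  apply: (@eq_from_nth _ 0%N) => [|k]; first by rewrite size_rev size_map size_iota.
  rewrite size_map size_iota => kn; rewrite (nth_map 0%N) ?size_iota //.
  rewrite nth_iota // nth_rev ?sE // add0n.
  by rewrite -(letter_perm rho (rev_ord (Ordinal kn)) sz) permE rev_ordK.
have sB : size (perm_setcomp b rho) = size b by rewrite size_map size_iota.
have dB : scdeg (perm_setcomp b rho) = n := scdegE (perm_blocks_proof b rho).
have b0 : 0%N \notin rev b by rewrite mem_rev composition_pos.
apply/eqP/(expandableP _ _ b0) => [/word_setcompP[v [lt_v]]|].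
  rewrite sB dB => sz; rewrite E // => ->; exists (rev v); rewrite ?size_rev //.
  by rewrite rev_sorted.
move=> [v [sz ->] lt_v]; apply/word_setcompP; exists (rev v).
  by rewrite sB rev_sorted size_rev sz size_rev.
by rewrite dB E ?revK // size_rev sz size_rev.
Qed.

(** * Maximal runs of weakly decreasing words, and coarsenings *)

Lemma sorted_geq_runs v : sorted geq v ->
  exists c u, [/\ size u = size c, 0%N \notin c, sorted gtn u & v = expand c u].
Proof.
elim: v => [|x v IH] sv; first by exists [::], [::].
have [c [u [sz c0 su vE]]] := IH (path_sorted sv).
case: u => [|y u] in sz su vE.
  by case: c => // in sz c0 vE; exists [:: 1%N], [:: x]; rewrite vE.
case: c => // -[|k] c in sz c0 vE; first by rewrite inE in c0.
rewrite vE expand_cons /= in sv; case/andP: sv => yx _.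
(* The new letter either lengthens the first run or starts a run of length 1. *)
case: (eqVneq y x) => [yxE|yxN].
  exists (k.+2 :: c), (y :: u); split=> //.
  by rewrite vE yxE.
exists [:: 1%N, k.+1 & c], [:: x, y & u]; split=> //=; first by case: sz => ->.
  by rewrite ltn_neqAle yxN yx.
by rewrite vE.
Qed.

(** The first letter exceeds all letters of later blocks, so its multiplicity in the word is the
    first part; cancel that block and induct. *)
Lemma expand_sorted_inj c c' u u' :
  0%N \notin c -> 0%N \notin c' -> size u = size c -> size u' = size c' ->
  sorted gtn u -> sorted gtn u' -> expand c u = expand c' u' -> c = c'.
Proof.
have tr : transitive gtn by move=> x y z /= yx xz; apply: ltn_trans xz yx.
elim: c u c' u' => [|k c IH] [|x u] // [|k' c'] [|x' u'] //.
- by case: k' => // k'; rewrite inE.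
- by case: k => // k; rewrite inE.
rewrite !inE !negb_or => /andP[k0 c0] /andP[k'0 c'0] [sz] [sz'].
rewrite /= !(path_sortedE tr) => /andP[xu su] /andP[xu' su'] E.
have xx' : x = x'.
  by move: E; case: k k0 => // k _; case: k' k'0 => // k' _ [].
rewrite -{x'}xx' in xu' E.
have cE d t : all (gtn x) t -> count_mem x (expand d t) = 0%N.
  move=> /allP xt; apply/count_memPn/negP => /mem_expand /xt /=.
  by rewrite ltnn.
have kk' : k = k'.
  have := congr1 (count_mem x) E; rewrite !expand_cons !count_cat !count_nseq.
  by rewrite !cE //= eqxx !mul1n !addn0.
congr (_ :: _) => //; apply: (IH u c' u') => //.
move: E; rewrite !expand_cons => /eqP; rewrite kk' eqseq_cat //.
by rewrite eqxx => /eqP.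
Qed.

Lemma refinesP a b :
  refines a b <-> exists bs, [/\ all (fun c => 0%N \notin c) bs,
    a = flatten bs & b = map sumn bs].
Proof.
split=> [[bs + ->]|[bs [+ -> ->]]].
  move=> bsb; exists bs; suff [] : all (fun c => 0%N \notin c) bs /\ b = map sumn bs by [].
  elim: bs b bsb => [|c bs IH] [|d b] //= /andP[/andP[-> /eqP ->] /IH[-> <-]].
  by [].
move=> bs0; exists bs => //.
by elim: bs bs0 => //= c bs IH /andP[c0 /IH ->]; rewrite /is_composition c0 eqxx.
Qed.

Lemma refines_rev a b : refines a b -> refines (rev a) (rev b).
Proof.
move=> /refinesP[bs [bs0 -> ->]]; apply/refinesP; exists (rev (map rev bs)); split.
- rewrite all_rev all_map; apply: sub_all bs0 => c /=.
  by rewrite mem_rev.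
- exact: rev_flatten.
- rewrite map_rev -map_comp; congr rev; apply: eq_map => c /=.
  by rewrite sumn_rev.
Qed.

Lemma refines_sumn a b : refines a b -> sumn a = sumn b.
Proof. by move=> /refinesP[bs [_ -> ->]]; rewrite sumn_flatten. Qed.

(* The coarsening [b] consists of the lengths of the maximal runs of [w]. *)
Lemma expandable_geq a w : 0%N \notin a ->
  expandable geq a w <->
  exists b, [/\ 0%N \notin b, refines a b & expandable gtn b w].
Proof.
move=> a0; split=> [/(expandableP _ _ a0)[v [sv ->] v_ge]|[b [b0]]].
  have [c [u [su c0 u_gt vE]]] := sorted_geq_runs v_ge.
  (* [c] lists the run lengths of the letter sequence [v], which has one letter per part of [a].
     Hence [reshape c a] groups the parts of [a] that share a letter. *)
  have sc : sumn c = size a by rewrite -(size_expand su) -vE.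
  have fE : flatten (reshape c a) = a by rewrite reshapeKr // sc.
  have sE : map size (reshape c a) = c by rewrite [LHS]reshapeKl // sc.
  have wE : expand a v = expand (map sumn (reshape c a)) u.
    by rewrite -expand_flatten ?fE ?sE -?vE // su -[in LHS]sE size_map.
  have r0 : all (fun d => 0%N \notin d) (reshape c a).
    apply/allP => d dr; apply: contra a0 => d0.
    by rewrite -fE; apply/flattenP; exists d.
  have b0 : 0%N \notin map sumn (reshape c a).
    apply/negP => /mapP[d dr]; have d0 := allP r0 _ dr.
    (* A group with sum 0 has no parts, but group sizes are entries of [c] and thus nonzero. *)
    case: d => [|[|e] d] // in dr d0 *; move=> _.
    case/negP: c0; rewrite -sE; apply/mapP; by exists [::].
  exists (map sumn (reshape c a)); split=> //; first by apply/refinesP; exists (reshape c a).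
  by rewrite wE expandable_expand // su -[in LHS]sE !size_map.
move=> /refinesP[bs [bs0 aE bE]] /(expandableP _ _ b0)[u [su wE] u_gt].
have szu : size u = size bs by rewrite su bE size_map.
(* Each letter of [u] is repeated once for every part of [a] in its group. *)
apply/(expandableP _ _ a0); exists (expand (map size bs) u).
  by rewrite wE aE expand_flatten // bE size_expand ?size_map // size_flatten.
apply: sorted_expand u_gt => //.
- by move=> x /=.
- by move=> x y /= /ltnW.
- by move=> x y z /= yx xz; apply: ltn_trans xz yx.
- by move=> x y z /= yx xz; apply: leq_trans xz yx.
Qed.

Lemma expandable_gtn_inj n (b b' : composition n) w :
  expandable gtn (rev b) w -> expandable gtn (rev b') w -> b = b'.
Proof.
have r0 (c : composition n) : 0%N \notin rev c by rewrite mem_rev composition_pos.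
move=> /(expandableP _ _ (r0 b))[u [su ->] u_gt].
move=> /(expandableP _ _ (r0 b'))[u' [su' E] u'_gt].
apply/val_inj/(can_inj revK).
exact: (expand_sorted_inj _ _ su su' u_gt u'_gt E).
Qed.

(** Compositions inject into the finite set of set compositions of degree [n], as any word of the
    image determines [b]. This turns the sum in [Eperm] into an honest finite sum. *)
Lemma finite_composition n (D : set (composition n)) : finite_set D.
Proof.
pose f (b : composition n) := perm_setcomp b (longest_perm n).
apply: (@sub_finite_set _ _ (f @^-1` [set C | scdeg C = n])).
  by move=> b _; apply: scdegE (perm_blocks_proof b _).
apply: finite_preimage; last exact: finite_setcomp.
move=> b b' _ _ E.
have cI : #|` Nn (size (f b))| = size (f b) by rewrite card_Nn.
have wE := word_xmonomial cI.
apply: (@expandable_gtn_inj _ _ _ (xmonomial (scdeg (f b)) (f b) (Nn (size (f b))))).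
  by rewrite -word_perm_longest -/(f b) wE.
by rewrite -word_perm_longest -/(f b') -E wE.
Qed.

(** At most one summand contains [w], namely the one whose reversed parts are the run lengths of
    [w]; it occurs in the sum exactly when these lengths coarsen [a]. *)
Lemma toseries_Eperm (R : pzRingType) n (a : composition n) w :
  toseries (Eperm R (rev_composition a) (longest_perm n)) w
  = (expandable geq a w)%:R.
Proof.
rewrite toseriesE /Eperm fsbig_finite; last exact: finite_composition.
rewrite coeff_sum /=; set D := fset_set _.
have DE b : (b \in D) = `[< refines (rev a) b >].
  rewrite in_fset_set; last exact: finite_composition.
  by apply/idP/asboolP; rewrite inE.
under eq_bigr => b _ do rewrite coeff_fbasis eq_sym word_perm_longest.
have [aw|aw] := boolP (expandable geq a w).
  have [c [c0 ac cw]] := (expandable_geq w (composition_pos a)).1 aw.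
  have bP : is_composition n (rev c).
    by rewrite /is_composition mem_rev c0 sumn_rev -(refines_sumn ac) sumn_composition eqxx.
  have bD : Composition bP \in D by rewrite DE; apply/asboolP/refines_rev.
  rewrite (big_fsetD1 _ bD) /= revK cw big_seq big1 ?addr0 // => b.
  rewrite !inE => /andP[bN _]; case: (boolP (expandable _ _ _)) => // bw.
  by case/eqP: bN; apply: expandable_gtn_inj bw _; rewrite /= revK.
rewrite big_seq big1 // => b; rewrite DE => /asboolP ab.
case: (boolP (expandable _ _ _)) => // bw; case/negP: aw.
apply/(expandable_geq w (composition_pos a)); exists (rev b); split=> //.
  by rewrite mem_rev composition_pos.
by rewrite -(revK a); apply: refines_rev.
Qed.

(** * The antipode recursion on interval set compositions *)

Lemma intervals_pos (A : setcomp) a : scblocks A = intervals 0 a -> 0%N \notin a.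
Proof.
have /and3P[+ _ _] := scblocksP A => A0 E; rewrite {}E in A0; apply: contra A0.
elim: a {2}0%N => //= c a IH s; rewrite !inE => /orP[/eqP <-|/IH ->].
  by apply/orP; left; apply/eqP/fsetP => i; rewrite !inE.
by rewrite orbT.
Qed.

Lemma toseries_intervals (R : pzRingType) (A : setcomp) a :
  scblocks A = intervals 0 a ->
  toseries (Mb R A) = fun w => (expandable ltn a w)%:R.
Proof.
move=> AE; have aP : is_composition (sumn a) a.
  by rewrite /is_composition (intervals_pos AE) eqxx.
have -> : A = perm_setcomp (Composition aP) 1%g.
  by apply: setcomp_eq; rewrite AE /= (perm_blocks1 (Composition aP)).
by apply: funext => w; rewrite toseries_basis MseriesE word_perm1.
Qed.

Lemma tensmap_fbasis (R : pzRingType) (K K' L L' : choiceType)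
    (f : {linear freemod R K -> freemod R K'})
    (g : {linear freemod R L -> freemod R L'}) k l :
  tensmap f g (tens (fbasis R k) (fbasis R l)) = tens (f (fbasis R k)) (g (fbasis R l)).
Proof. by rewrite /tensmap [tens (fbasis R k) _]/tens !linext_fbasis. Qed.

Lemma toseries_convolution (R : comPzRingType)
    (f g : {linear ncqsym R -> ncqsym R}) (A : setcomp) w :
  toseries (convolution f g (Mb R A)) w =
  \sum_(k < (size A).+1) ncseries_mul (toseries (f (Mb R (sttake k A))))
                           (toseries (g (Mb R (stdrop k A)))) w.
Proof.
rewrite toseriesE /convolution /nccomul linext_fbasis big_mkord.
rewrite /tensmap linear_sum /ncmul linear_sum coeff_sum; apply: eq_bigr => k _.
by rewrite /= -/(tensmap f g _) tensmap_fbasis -/(ncmul _) -toseriesE toseries_mul.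
Qed.

(** The proposed antipode values satisfy S * id = eps: the test that [w] is constant on the blocks
    factors out, leaving [sum_sorted_nil] for its letters. *)
Lemma sum_ncseries_mul (R : comPzRingType) a w : 0%N \notin a ->
  \sum_(k < (size a).+1)
     ncseries_mul (fun u => (-1) ^+ k * (expandable geq (take k a) u)%:R)
       (fun u => (expandable ltn (drop k a) u)%:R) w
  = ((a == [::]) && (w == [::]))%:R :> R.
Proof.
move=> a0.
have mulE (k : nat) : ncseries_mul
       (fun u => (-1) ^+ k * (expandable geq (take k a) u)%:R : R)
       (fun u => (expandable ltn (drop k a) u)%:R) w =
    (w == expand a (letters a w))%:R * ((-1) ^+ k *
      (sorted geq (take k (letters a w)) && sorted ltn (drop k (letters a w)))%:R).
  rewrite mulrCA -natrM mulnb -ncseries_mul_expandable // /ncseries_mul mulr_sumr.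
  by apply: eq_bigr => i _; rewrite mulrA.
under eq_bigr => k _ do rewrite mulE.
have := sum_sorted_nil R (letters a w); rewrite size_letters -mulr_sumr => ->.
rewrite -natrM mulnb andbC.
by case: a {a0 mulE}.
Qed.

(** In S * id = eps the last cut contributes S(M_A) times the unit, and every other cut involves S
    on fewer blocks, so the values of S are forced recursively. Allowing any [A] with interval
    blocks lets the induction apply directly to [sttake k A]. *)
Lemma antipode_intervals (R : comPzRingType)
    (S : {linear ncqsym R -> ncqsym R}) (A : setcomp) a :
  (forall u, convolution S idfun u = ncunit (nccounit u)) ->
  scblocks A = intervals 0 a ->
  toseries (S (Mb R A)) = fun w => (-1) ^+ size a * (expandable geq a w)%:R.
Proof.
move=> SP; have [m] := ubnP (size a); elim: m A a => // m IH A a am AE.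
have a0 := intervals_pos AE; apply: funext => w.
have sA : size A = size a by rewrite AE size_intervals.
have tE k : scblocks (sttake k A) = intervals 0 (take k a).
  by rewrite /= AE take_intervals st_intervals.
have dE k : scblocks (stdrop k A) = intervals 0 (drop k a).
  by rewrite /= AE drop_intervals st_intervals.
have emptyE : (fun u => (expandable ltn [::] u)%:R) = ncseries1 R.
  by apply: funext => u; rewrite /expandable andbT.
have := toseries_convolution S idfun A w; rewrite SP sA.
have -> : toseries (ncunit (nccounit (Mb R A))) w
    = ((a == [::]) && (w == [::]))%:R.
  rewrite toseriesE coeffZ -toseriesE toseries_unit /nccounit coeff_fbasis.
  rewrite -natrM mulnb; congr ((_ && _)%:R); apply/eqP/eqP => [A0|a_nil].
    by apply: size0nil; rewrite -sA A0.
  by apply: setcomp_eq; rewrite AE a_nil.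
(* The co-unit is replaced by the alternating sum of the proposed values. Both sides then agree for
   k < [size a] by induction, and cancelling leaves the terms at k = [size a]. *)
rewrite -(sum_ncseries_mul R w a0) !big_ord_recr /=.
under eq_bigr => k _.
  rewrite -{1}(size_takel (ltnW (ltn_ord k))) -(IH _ _ _ (tE k)).
    rewrite -(toseries_intervals R (dE k)); over.
  by rewrite size_takel ?(ltnW (ltn_ord k)) //; apply: leq_trans (ltn_ord k) am.
move=> /addrI /esym.
have -> : sttake (size a) A = A by apply: setcomp_eq; rewrite tE take_size AE.
rewrite (toseries_intervals R (dE _)) drop_size take_size emptyE.
by rewrite !ncseries_mul1.
Qed.

Theorem proposition4p37 (R : comPzRingType)
    (S : {linear ncqsym R -> ncqsym R}) (antipodeS : is_antipode S)
    (n : nat) (a : composition n) :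
  S (Mperm R a 1%g) =
  (-1) ^+ size a *: Eperm R (rev_composition a) (longest_perm n).
Proof.
case: antipodeS => SP _; apply: toseries_inj.
rewrite (antipode_intervals (A := perm_setcomp a 1%g) SP (perm_blocks1 a)); apply: funext => w.
by rewrite [RHS]toseriesE coeffZ -toseriesE toseries_Eperm.
Qed.
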